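(* Let $X$ be a uniformly perfect metric space with more than one point and let $F\subseteq X$ be non-empty and totally bounded. If $0\le\dim_{\mathrm L}F<\dim_{\mathrm A}F<\infty$ and $0<\theta\le\phi\le1$ then $$\overline{\dim}_\theta F\le\overline{\dim}_\phi F\le\overline{\dim}_\theta F+\frac{(\overline{\dim}_\theta F-\dim_{\mathrm L}F)(\dim_{\mathrm A}F-\overline{\dim}_\theta F)}{\phi(\overline{\dim}_\theta F-\dim_{\mathrm L}F)+\theta(\dim_{\mathrm A}F-\overline{\dim}_\theta F)}(\phi-\theta).$$ The same holds with $\overline{\dim}$ replaced by $\underline{\dim}$ throughout. Furthermore, the functions $\theta'\mapsto\overline{\dim}_{\theta'}F$ and $\theta'\mapsto\underline{\dim}_{\theta'}F$ are continuous for $\theta'\in(0,1]$; indeed they are both Lipschitz on $[\theta,1]$ with Lipschitz constant $\frac{\dim_{\mathrm A}F}{4\theta}$.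
   Context: For a subset $U$ of a metric space, $|U|$ denotes its diameter, and $B(x,r)$ is the open ball. Convention: $\inf\varnothing=\infty$. A metric space $X$ is uniformly perfect if there is $c\in(0,1)$ such that $B(x,R)\setminus B(x,cR)\neq\varnothing$ for all $x\in X$ and $0<R<|X|$. $N_\delta(F)$ is the smallest number of open balls of radius $\delta/2$ with centres in $F$ needed to cover $F$; $F$ is totally bounded if $N_\delta(F)<\infty$ for all $\delta>0$. Intermediate dimensions: for $\theta\in(0,1)$, the upper $\theta$-intermediate dimension $\overline{\dim}_\theta F$ is the infimum of all $s\ge0$ such that for all $\epsilon>0$ there exists $\delta_0\in(0,1]$ such that for all $\delta\in(0,\delta_0)$ there is a finite or countable cover $\{U_1,U_2,\dots\}$ of $F$ by subsets of $X$ with $\delta^{1/\theta}\le|U_i|\le\delta$ for all $i$ and $\sum_i|U_i|^s\le\epsilon$. The lower $\theta$-intermediate dimension $\underline{\dim}_\theta F$ is the infimum of all $s\ge0$ such that for all $\epsilon>0$ and $\delta_0\in(0,1]$ there exist $\delta\in(0,\delta_0)$ and such a cover with $\delta^{1/\theta}\le|U_i|\le\delta$ for all $i$ and $\sum_i|U_i|^s\le\epsilon$. For $\theta=1$, $\overline{\dim}_1F:=\overline{\dim}_{\mathrm B}F$ and $\underline{\dim}_1F:=\underline{\dim}_{\mathrm B}F$, the $\limsup$ and $\liminf$ as $\delta\to0^+$ of $\log N_\delta(F)/(-\log\delta)$. The Assouad dimension $\dim_{\mathrm A}F$ is the infimum of all $a$ for which there exists $C>0$ such that $N_r(B(x,R)\cap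 F)\le C(R/r)^a$ for all $x\in F$ and $0<r<R$. The lower dimension $\dim_{\mathrm L}F$ (for $F$ with more than one point) is the supremum of all $\lambda$ for which there exists $C>0$ such that $N_r(B(x,R)\cap F)\ge C(R/r)^\lambda$ for all $x\in F$ and $0<r<R\le|F|$. *)

(* Defs.v *)
From mathcomp Require Export all_boot all_order all_algebra.
From mathcomp Require Export all_classical all_reals all_analysis.
Export numFieldNormedType.Exports.

Set Implicit Arguments.
Unset Strict Implicit.
Unset Printing Implicit Defensive.

Import Order.TTheory GRing.Theory Num.Theory.
Local Open Scope classical_set_scope.
Local Open Scope ring_scope.

(* The point 0 is added so that the diameter of the empty set is 0 rather
   than ereal_sup set0 = -oo. *)
Definition diam (R : realType) (X : metricType R) (U : set X) : \bar R :=
  ereal_sup (0%E |` [set (mdist x y)%:E | x in U & y in U]).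

Definition uniformly_perfect (R : realType) (X : metricType R) : Prop :=
  exists2 c : R, 0 < c < 1 &
    forall (x : X) (r : R), 0 < r -> (r%:E < diam [set: X])%E ->
      ball x r `\` ball x (c * r) !=set0.

(* The covering number is +oo when no finite cover exists. *)
Definition covering_number (R : realType) (X : metricType R) (delta : R)
    (F : set X) : \bar R :=
  ereal_inf [set (size s)%:R%:E | s in
    [set s : seq X | [set` s] `<=` F /\
                     F `<=` \bigcup_(x in [set` s]) ball x (delta / 2)]].

Definition totally_bounded_set (R : realType) (X : metricType R)
    (F : set X) : Prop :=
  forall delta : R, 0 < delta -> (covering_number delta F < +oo)%E.

Definition box_ratio (R : realType) (X : metricType R) (F : set X)
    (delta : R) : \bar R :=
  (lne (covering_number delta F) * (- ln delta)^-1%:E)%E.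

Definition upper_box_dim (R : realType) (X : metricType R) (F : set X)
    : \bar R :=
  limf_esup (box_ratio F) (0 : R)^'+.

Definition lower_box_dim (R : realType) (X : metricType R) (F : set X)
    : \bar R :=
  limf_einf (box_ratio F) (0 : R)^'+.

(* The index set D of the cover is an arbitrary set of naturals, so that both
   finite and countably infinite covers are allowed. *)
Definition admissible_cover (R : realType) (X : metricType R) (F : set X)
    (theta s eps delta : R) : Prop :=
  exists (D : set nat) (U : nat -> set X),
    [/\ F `<=` \bigcup_(i in D) U i,
        forall i, D i ->
          ((delta `^ theta^-1)%:E <= diam (U i) <= delta%:E)%E
      & (\esum_(i in D) (diam (U i) `^ s) <= eps%:E)%E].

Definition upper_intermediate_dim (R : realType) (X : metricType R)
    (theta : R) (F : set X) : \bar R :=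
  if theta == 1 then upper_box_dim F else
  ereal_inf [set s%:E | s in [set s : R | 0 <= s /\
    forall eps : R, 0 < eps ->
    exists2 delta0 : R, 0 < delta0 <= 1 &
    forall delta : R, 0 < delta < delta0 ->
      admissible_cover F theta s eps delta]].

Definition lower_intermediate_dim (R : realType) (X : metricType R)
    (theta : R) (F : set X) : \bar R :=
  if theta == 1 then lower_box_dim F else
  ereal_inf [set s%:E | s in [set s : R | 0 <= s /\
    forall eps delta0 : R, 0 < eps -> 0 < delta0 <= 1 ->
    exists2 delta : R, 0 < delta < delta0 &
      admissible_cover F theta s eps delta]].

Definition assouad_dim (R : realType) (X : metricType R) (F : set X)
    : \bar R :=
  ereal_inf [set a%:E | a in [set a : R |
    exists2 C : R, 0 < C &
    forall (x : X) (r rho : R), F x -> 0 < r < rho ->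
      (covering_number r (ball x rho `&` F) <= (C * (rho / r) `^ a)%:E)%E]].

Definition lower_dim (R : realType) (X : metricType R) (F : set X)
    : \bar R :=
  ereal_sup [set l%:E | l in [set l : R |
    exists2 C : R, 0 < C &
    forall (x : X) (r rho : R), F x -> 0 < r < rho -> (rho%:E <= diam F)%E ->
      ((C * (rho / r) `^ l)%:E <= covering_number r (ball x rho `&` F))%E]].

(* Main.v *)
Require Import Defs.
From mathcomp Require Import ring lra.

(* A cover witnessing dimension [s] at [theta], at scale [delta], is turned
   into one for [phi >= theta] at scale [delta `^ gamma].  Its sets of diameter
   above [delta `^ gamma] are subdivided, which costs at most the exponent
   [a - (a - s) / gamma] for any [a > dim_A F]; those of diameter below
   [delta `^ (gamma / phi)] are merged, and since covers of a ball of [F] of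
   radius [r] have [l]-dimensional cost at least a constant times [r `^ l] for
   any [l < dim_L F], this costs at most the exponent
   [l + phi * (s - l) / (gamma * theta)].  The value of [gamma] equating the
   two exponents gives the bound, and the Lipschitz constant then follows from
   AM-GM. *)

Set Implicit Arguments.
Unset Strict Implicit.
Unset Printing Implicit Defensive.

Import Order.TTheory GRing.Theory Num.Theory.
Local Open Scope classical_set_scope.
Local Open Scope ring_scope.

(** * Covers by finitely many balls *)

(** The estimates concern finite covers by balls centred in [F], measured by their radii and with
    sums merely bounded. Centres in [F] let the Assouad and lower dimensions act on each ball;
    boundedness suffices because any increase of the exponent makes the sums tend to zero with the
    scale. In this form the box dimensions are the case [theta = 1]. Returning to diameters is where
    uniform perfectness enters: a ball could otherwise have diameter far below its radius. Merging
    rests on a lower bound for the cost of the small sets around each replaced ball, which is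
    available only where no large set helps; points near large sets are therefore absorbed into
    enlargements of these. *)

Lemma le_sum_seq (R : numDomainType) (I : eqType) (r : seq I) (P : pred I)
    (f g : I -> R) :
  (forall i, i \in r -> P i -> f i <= g i) ->
  \sum_(i <- r | P i) f i <= \sum_(i <- r | P i) g i.
Proof.
move=> fg; rewrite big_seq_cond [leRHS]big_seq_cond.
by apply: ler_sum => i /andP[ri Pi]; exact: fg.
Qed.

Lemma le_sum_seq_mem (R : numDomainType) (I : eqType) (r : seq I) (f : I -> R)
    (i : I) : (forall j, 0 <= f j) -> i \in r -> f i <= \sum_(j <- r) f j.
Proof. by move=> f0 ri; rewrite (big_rem i)//= lerDl sumr_ge0. Qed.

Section ball_covers.
Context {R : realType} {X : metricType R}.
Implicit Types (F G : set X) (L : seq (X * R)) (Z : seq X).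

Lemma ball_mdist (x y : X) (r : R) : ball x r y <-> mdist x y < r.
Proof. by rewrite ballEmdist. Qed.

Definition ball_cover F (lo hi t : R) G (K : R) : Prop :=
  exists L : seq (X * R),
    [/\ forall p, p \in L -> F p.1 /\ lo <= p.2 <= hi,
        forall x, G x -> exists2 p, p \in L & ball p.1 p.2 x
      & \sum_(p <- L) p.2 `^ t <= K].

Lemma ball_coverW F lo lo' hi hi' t G G' K K' : lo' <= lo -> hi <= hi' ->
  G' `<=` G -> K <= K' -> ball_cover F lo hi t G K ->
  ball_cover F lo' hi' t G' K'.
Proof.
move=> lo'lo hihi' G'G KK' [L [LF LG LK]]; exists L; split.
- move=> p /LF[Fp /andP[lop phi]]; split => //.
  by rewrite (le_trans lo'lo)//= (le_trans phi).
- by move=> x /G'G; exact: LG.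
- exact: le_trans KK'.
Qed.

Lemma ball_coverU F lo hi t G1 G2 K1 K2 : ball_cover F lo hi t G1 K1 ->
  ball_cover F lo hi t G2 K2 -> ball_cover F lo hi t (G1 `|` G2) (K1 + K2).
Proof.
move=> [L1 [L1F L1G L1K]] [L2 [L2F L2G L2K]]; exists (L1 ++ L2); split.
- by move=> p; rewrite mem_cat => /orP[/L1F|/L2F].
- by move=> x [/L1G|/L2G] [p pL px]; exists p; rewrite ?mem_cat ?pL ?orbT.
- by rewrite big_cat lerD.
Qed.

Lemma ball_cover_bigcup (I : eqType) (r : seq I) (G : I -> set X) (K : I -> R)
    F lo hi t : (forall i, i \in r -> ball_cover F lo hi t (G i) (K i)) ->
  ball_cover F lo hi t (\bigcup_(i in [set` r]) G i) (\sum_(i <- r) K i).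
Proof.
elim: r => [|i r ih] H.
  by exists [::]; split => //; [move=> x []|rewrite !big_nil].
rewrite big_cons.
have H1 := H i (mem_head _ _).
have H2 : ball_cover F lo hi t (\bigcup_(i in [set` r]) G i) (\sum_(i <- r) K i).
  by apply: ih => j jr; apply: H; rewrite in_cons jr orbT.
apply: ball_coverW (ball_coverU H1 H2) => // x [j /=].
by rewrite in_cons => /predU1P[->|jr] Gx; [left|right; exists j].
Qed.

Lemma ball_cover_const F r t G (s : seq X) : [set` s] `<=` F ->
  G `<=` \bigcup_(x in [set` s]) ball x r ->
  ball_cover F r r t G ((size s)%:R * r `^ t).
Proof.
move=> sF sG; exists [seq (x, r) | x <- s]; split.
- by move=> p /mapP[x xs ->]/=; rewrite lexx; split => //; exact: sF.
- by move=> x /sG[y ys yx]; exists (y, r) => //; exact: map_f.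
- by rewrite big_map/= big_const_seq count_predT iter_addr_0 mulr_natl.
Qed.

Lemma covering_number_lt (d K : R) G : (covering_number d G < K%:E)%E ->
  exists s : seq X, [/\ [set` s] `<=` G,
    G `<=` \bigcup_(x in [set` s]) ball x (d / 2) & (size s)%:R < K].
Proof.
by move=> /ereal_inf_lt[_ [s [sG Gs] <-]]; rewrite lte_fin => sK; exists s.
Qed.

Lemma covering_number_le_size (d : R) G (s : seq X) : [set` s] `<=` G ->
  G `<=` \bigcup_(x in [set` s]) ball x (d / 2) ->
  (covering_number d G <= (size s)%:R%:E)%E.
Proof. by move=> sG Gs; apply: ereal_inf_lbound; exists s. Qed.

(** A greedy choice along a finite cover of [F] by balls of radius [r / 2]: two points in one of
    these balls are less than [r] apart, so one new point per ball is enough. *)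
Lemma separated_net F G (r : R) : totally_bounded_set F -> G `<=` F -> 0 < r ->
  exists Z : seq X, [/\ uniq Z, [set` Z] `<=` G,
    {in Z &, forall x y, x != y -> r <= mdist x y}
    & G `<=` \bigcup_(z in [set` Z]) ball z r].
Proof.
move=> totF GF r0.
have [_ [s [_ Fs] _] _] := ereal_inf_lt (totF _ r0).
suff [Z [uZ ZG Zsep Zcov]] : exists Z : seq X, [/\ uniq Z, [set` Z] `<=` G,
    {in Z &, forall x y, x != y -> r <= mdist x y}
    & forall g, G g -> (exists2 x, x \in s & ball x (r / 2) g) ->
        exists2 z, z \in Z & ball z r g].
  exists Z; split => // g Gg.
  by have [x xs xg] := Fs _ (GF _ Gg); apply: Zcov => //; exists x.
elim: s {Fs} => [|x s [Z [uZ ZG Zsep Zcov]]].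
  by exists [::]; split => // g _ [].
have [[g0 [Gg0 xg0 g0Z]]|nog0] := pselect (exists g0, [/\ G g0,
    ball x (r / 2) g0 & forall z, z \in Z -> ~ ball z r g0]).
- have dZ z : z \in Z -> r <= mdist z g0.
    by move=> /g0Z; rewrite ball_mdist => /negP; rewrite -leNgt.
  exists (g0 :: Z); split.
  + rewrite /= uZ andbT; apply/negP => /dZ; rewrite mdistxx; lra.
  + by move=> y /=; rewrite in_cons => /predU1P[->//|]; exact: ZG.
  + move=> y z; rewrite !in_cons => /predU1P[->|yZ] /predU1P[->|zZ].
    * by rewrite eqxx.
    * by rewrite metric_sym => _; exact: dZ.
    * by move=> _; exact: dZ.
    * exact: Zsep.
  + move=> g Gg [y]; rewrite in_cons => /predU1P[->|ys] yg.
      exists g0; first exact: mem_head.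
      by rewrite (splitr r); exact: ball_triangle (ball_sym xg0) yg.
    have [|z zZ zg] := Zcov g Gg; first by exists y.
    by exists z => //; rewrite in_cons zZ orbT.
- exists Z; split => // g Gg [y]; rewrite in_cons => /predU1P[->|ys] yg.
    apply: contrapT => gZ; apply: nog0; exists g; split => // z zZ zg.
    by apply: gZ; exists z.
  by apply: Zcov => //; exists y.
Qed.

Definition meets (z : X) (rho : R) (p : X * R) : bool :=
  `[< exists2 u, ball z rho u & ball p.1 p.2 u >].

(* A ball of radius at most [rho] meets at most one of the balls of radius
   [rho] about a [4 * rho]-separated set, so the sums over these do not
   overlap. *)
Lemma separated_sum L Z (rho B : R) (f : X * R -> R) :
  uniq Z -> {in Z &, forall x y, x != y -> 4 * rho <= mdist x y} ->
  (forall p, p \in L -> p.2 <= rho) ->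
  (forall p, 0 <= f p) ->
  (forall z, z \in Z -> B <= \sum_(p <- L | meets z rho p) f p) ->
  (size Z)%:R * B <= \sum_(p <- L) f p.
Proof.
move=> uZ sepZ Lrho f0 BZ.
have -> : (size Z)%:R * B = \sum_(z <- Z) B.
  by rewrite big_const_seq count_predT iter_addr_0 mulr_natl.
apply: le_trans (le_sum_seq (fun z zZ _ => BZ z zZ)) _.
rewrite (exchange_big_dep predT)//=; apply: le_sum_seq => p pL _.
have [/hasP[z zZ zp]|/hasPn noz] := boolP (has (fun z => meets z rho p) Z).
- rewrite big_mkcond (bigD1_seq z)//= zp big_seq_cond big1 ?addr0// => y.
  move=> /andP[yZ yz]; case: ifPn => // /asboolP[u yu pu]; exfalso.
  move/asboolP : zp => [v zv pv].
  have := sepZ _ _ yZ zZ yz; have := Lrho _ pL.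
  move: yu pu zv pv; rewrite !ball_mdist.
  have := metric_triangle y u z; have := metric_triangle u p.1 z.
  have := metric_triangle p.1 v z; rewrite (metric_sym u p.1) (metric_sym v z); lra.
- rewrite big_seq_cond big1 // => y /andP[yZ].
  by rewrite (negbTE (noz _ yZ)).
Qed.

End ball_covers.

(** * Content bound from the lower dimension *)

Section powR_facts.
Context {R : realType}.
Implicit Types x y s t : R.

Lemma powR_le_base s x y : 0 <= s -> 0 <= x -> x <= y -> x `^ s <= y `^ s.
Proof.
by move=> s0 x0 xy; apply: ge0_ler_powR; rewrite ?nnegrE// (le_trans x0).
Qed.

Lemma powR_ge_base s x y : s <= 0 -> 0 < x -> x <= y -> y `^ s <= x `^ s.
Proof.
move=> s0 x0 xy; rewrite -[s]opprK !(powRN _ (- s)).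
rewrite lef_pV2 ?posrE ?powR_gt0// ?(lt_le_trans x0)//.
by apply: powR_le_base; rewrite ?oppr_ge0// ltW.
Qed.

Lemma powR_le_exp x s t : 0 < x <= 1 -> s <= t -> x `^ t <= x `^ s.
Proof. by move=> x01 st; exact: ger_powR. Qed.

Lemma powR_add x s t : 0 < x -> x `^ (s + t) = x `^ s * x `^ t.
Proof. by move=> x0; rewrite powRD// (gt_eqF x0) implybT. Qed.

Lemma powR_sub x s t : 0 < x -> x `^ (s - t) = x `^ s / x `^ t.
Proof. by move=> x0; rewrite powRB// (gt_eqF x0) implybT. Qed.

Lemma powR_mul x y s : 0 < x -> 0 < y -> (x * y) `^ s = x `^ s * y `^ s.
Proof. by move=> x0 y0; rewrite powRM// ltW. Qed.

Lemma powR_div x y s : 0 < x -> 0 < y -> (x / y) `^ s = x `^ s / y `^ s.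
Proof.
by move=> x0 y0; rewrite powR_mul ?invr_gt0// -(powR_inv1 (ltW y0)) -powRrM
  mulN1r powRN.
Qed.

Lemma powR_inv_cancel x s : 0 <= x -> s != 0 -> (x `^ s^-1) `^ s = x.
Proof. by move=> x0 s0; rewrite -powRrM mulVf// powRr1. Qed.

End powR_facts.

Section content.
Context {R : realType} {X : metricType R}.
Implicit Types (F G : set X) (L : seq (X * R)).

(** A power-law lower bound on the [l]-dimensional content of [F] in small balls, the substitute for
    a mass distribution. Requiring radii at most [rho] keeps it meaningful for negative [l], where
    large balls would be cheap. *)
Definition content_bound F (l : R) : Prop :=
  exists c rho1 : R, [/\ 0 < c, 0 < rho1 &
    forall (x : X) (rho : R) (L : seq (X * R)), F x -> 0 < rho <= rho1 ->
      (forall p, p \in L -> 0 < p.2 <= rho) ->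
      (forall u, ball x rho u -> F u -> exists2 p, p \in L & ball p.1 p.2 u) ->
      c * rho `^ l <= \sum_(p <- L) p.2 `^ l].

(** Supplies the number of steps for the induction on scales: a finite list of positive radii is
    bounded away from 0. *)
Lemma exp_below (tau rho : R) (L : seq (X * R)) : 0 < tau <= 2^-1 ->
  (forall p, p \in L -> 0 < p.2) ->
  exists n, forall p, p \in L -> tau ^+ n * rho <= p.2.
Proof.
move=> /andP[tau0 tau2] L0.
suff [m m0 mL] : exists2 m : R, 0 < m & forall p, p \in L -> m <= p.2.
  exists (Num.bound (rho / m)) => p pL; apply: le_trans (mL p pL).
  have H := upper_nthrootP (leqnn (Num.bound (rho / m))).
  set n := Num.bound _ in H *.
  have n0 : 0 < (2:R) ^+ n by rewrite exprn_gt0.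
  have taun : tau ^+ n <= (2 ^+ n)^-1.
    by rewrite -exprVn; apply: lerXn2r; rewrite ?nnegrE ?invr_ge0// ltW.
  have [rho0|rho0] := leP rho 0.
    by apply: le_trans (ltW m0); rewrite mulr_ge0_le0// exprn_ge0// ltW.
  apply: le_trans (ler_wpM2r (ltW rho0) taun) _.
  by rewrite mulrC ler_pdivrMr// mulrC -ler_pdivrMr// ltW.
elim: L L0 => [|p L ih] L0; first by exists 1.
have [m m0 mL] : exists2 m : R, 0 < m & forall p, p \in L -> m <= p.2.
  by apply: ih => q qL; apply: L0; rewrite in_cons qL orbT.
exists (Num.min m p.2); first by rewrite lt_min m0 L0 ?mem_head.
move=> q; rewrite in_cons => /predU1P[->|/mL mq]; last by rewrite ge_min mq.
by rewrite ge_min lexx orbT.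
Qed.

(* Each scale step replaces a ball of radius [rho] by at least [tau `^ (- l)]
   well-separated balls of radius [tau * rho]; a mass-distribution argument
   by induction on the number of steps then bounds every finite cover. *)
Lemma lower_dim_content_gt0 F (l : R) : totally_bounded_set F ->
  (0 < diam F)%E -> 0 < l -> (l%:E < lower_dim F)%E -> content_bound F l.
Proof.
move=> totF dF l0 /ereal_sup_gt[_ [l' [C C0 HC] <-]]; rewrite lte_fin => ll'.
have [rho1 rho10 rho1F] : exists2 r : R, 0 < r & (r%:E <= diam F)%E.
  case: (diam F) dF => [r|_|//]; last by exists 1; rewrite ?leey.
  by rewrite lte_fin => r0; exists r.
have l'l : 0 < l' - l by rewrite subr_gt0.
(* One step yields at least [A * tau^(-l')] net points, and the second term of [tau] makes this at
   least [tau^(-l)]. The bound [1/32] keeps the balls of radius [tau * rho] inside the ball of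
   radius [rho] and ensures [8 * (tau * rho) < rho / 2]. *)
set A := C / 16 `^ l'.
have A0 : 0 < A by rewrite divr_gt0// powR_gt0.
pose tau := Num.min (32^-1) (A `^ (l' - l)^-1).
have tau0 : 0 < tau by rewrite /tau lt_min powR_gt0// andbT.
have tau32 : tau <= 32^-1 by rewrite /tau ge_min lexx.
have tauA : tau `^ (l' - l) <= A.
  rewrite -[leRHS](powR_inv_cancel (ltW A0) (lt0r_neq0 l'l)).
  by apply: powR_le_base; rewrite ?(ltW tau0, ltW l'l)// /tau ge_min lexx orbT.
(* The loss [tau^l] pays for a cover containing a ball of radius at least [tau * rho], which
   suffices by itself. It does not accumulate, since the number of subballs makes up for their
   smaller radius. *)
have step n x rho L : F x -> 0 < rho <= rho1 ->
    (forall p, p \in L -> tau ^+ n * rho <= p.2) ->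
    (forall u, ball x rho u -> F u -> exists2 p, p \in L & ball p.1 p.2 u) ->
    tau `^ l * rho `^ l <= \sum_(p <- L) p.2 `^ l.
  elim: n x rho L => [|n ih] x rho L Fx /andP[rho0 rhorho1] Lrho Lx.
    have [|p pL _] := Lx x _ Fx; first exact: ballxx.
    apply: le_trans (le_sum_seq_mem _ pL) => [|q]; last exact: powR_ge0.
    rewrite -powR_mul//; apply: powR_le_base; rewrite ?(ltW l0)//.
      by rewrite mulr_ge0// ltW.
    apply: le_trans (Lrho _ pL); rewrite expr0 ler_wpM2r ?(ltW rho0)//; lra.
  have taurho : 0 < tau * rho by rewrite mulr_gt0.
  have taurho_le : tau * rho <= rho / 32 by nra.
  have [/hasP[p pL taup]|/hasPn Lsmall] := boolP (has (fun p => tau * rho <= p.2) L).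
    apply: le_trans (le_sum_seq_mem _ pL) => [|q]; last exact: powR_ge0.
    by rewrite -powR_mul//; apply: powR_le_base; rewrite ?(ltW l0) ?(ltW taurho).
  have [|Z [uZ ZG Zsep Zcov]] :=
      @separated_net _ _ F (ball x (rho / 2) `&` F) (4 * (tau * rho)) totF (@subIsetr _ _ _).
    by rewrite mulr_gt0.
  have ZB z : z \in Z -> tau `^ l * (tau * rho) `^ l <=
      \sum_(p <- L | meets z (tau * rho) p) p.2 `^ l.
    move=> zZ; have [xz Fz] := ZG _ zZ; rewrite -big_filter; apply: (ih z) => //.
    - by rewrite taurho/=; lra.
    - move=> p; rewrite mem_filter => /andP[_ pL].
      by rewrite mulrA -exprSr; exact: Lrho.
    - move=> u zu Fu; have [|p pL pu] := Lx u _ Fu.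
        move: xz zu; rewrite !ball_mdist; have := metric_triangle x z u; lra.
      by exists p => //; rewrite mem_filter pL andbT; apply/asboolP; exists u.
  have Lle p : p \in L -> p.2 <= tau * rho.
    by move=> /Lsmall; rewrite -ltNge => /ltW.
  apply: le_trans (separated_sum uZ Zsep Lle (fun p => powR_ge0 p.2 l) ZB).
  (* [covering_number] halves its argument, so a net of radius [4 * (tau * rho)] is compared with
     the covering number at [8 * (tau * rho)]. *)
  have sZ : C * (rho / 2 / (8 * (tau * rho))) `^ l' <= (size Z)%:R.
    rewrite -lee_fin; apply: le_trans (covering_number_le_size ZG _).
    - apply: HC => //; first by apply/andP; split; lra.
      by apply: le_trans rho1F; rewrite lee_fin; lra.
    - by move=> u /Zcov[z zZ zu]; exists z => //; congr (ball _ _ _) : zu; field.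
  have eqr : rho / 2 / (8 * (tau * rho)) = (16 * tau)^-1.
    by field; rewrite !gt_eqF.
  rewrite eqr -[X in X `^ l']mul1r powR_div ?mulr_gt0// powR1 mul1r powR_mul// in sZ.
  have -> : (size Z)%:R * (tau `^ l * (tau * rho) `^ l) =
      tau `^ l * (tau `^ l * (size Z)%:R) * rho `^ l by rewrite powR_mul//; ring.
  rewrite ler_pM2r ?powR_gt0//.
  rewrite ler_peMr ?powR_ge0//.
  have tl : 0 < tau `^ l by rewrite powR_gt0.
  have tl' : 0 < tau `^ l' by rewrite powR_gt0.
  have s16 : 0 < (16:R) `^ l' by rewrite powR_gt0.
  rewrite powR_sub// ler_pdivrMr// in tauA.
  apply: le_trans (ler_wpM2l (ltW tl) sZ).
  have -> : tau `^ l * (C * (16 `^ l' * tau `^ l')^-1) = A * tau `^ l / tau `^ l'.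
    by rewrite /A; field; rewrite !gt_eqF.
  by rewrite ler_pdivlMr// mul1r.
exists (tau `^ l), rho1; split => // [|x rho L Fx rhorho1 L0 Lx].
  by rewrite powR_gt0.
have [|p /L0/andP[]//|n Ln] := @exp_below tau rho L; first by rewrite tau0/=; lra.
exact: (step n x).
Qed.

(** For [l <= 0] the one ball containing the centre already costs at least [rho^l]. This case arises
    when the lower dimension is 0, as the exponents used lie strictly below it. *)
Lemma lower_dim_content F (l : R) : totally_bounded_set F ->
  (0 < diam F)%E -> (l%:E < lower_dim F)%E -> content_bound F l.
Proof.
move=> totF dF lF; have [l0|l0] := leP l 0; last exact: lower_dim_content_gt0.
exists 1, 1; split => // x rho L Fx /andP[rho0 _] L0 Lx.
have [|p pL _] := Lx x _ Fx; first exact: ballxx.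
have /andP[p0 prho] := L0 _ pL.
rewrite mul1r; apply: le_trans (le_sum_seq_mem _ pL) => [|q]; last exact: powR_ge0.
exact: powR_ge_base.
Qed.

End content.

(** * Transfer of covers between scales *)

Section transfer.
Context {R : realType} {X : metricType R}.
Implicit Types (F G : set X).

(** The exponent [t] is free because every ball has radius [r]: it enters only through the factor
    [r^t]. *)
Definition assouad_bound F (a : R) : Prop :=
  exists2 C : R, 0 < C & forall (t : R) (x : X) (r rho : R), F x ->
    0 < r < rho ->
    ball_cover F r r t (ball x rho `&` F) (C * (rho / r) `^ a * r `^ t).

Lemma assouad_dim_bound F (a : R) : (assouad_dim F < a%:E)%E ->
  assouad_bound F a.
Proof.
move=> /ereal_inf_lt[_ [a' [C C0 HC] <-]]; rewrite lte_fin => a'a.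
(* Doubling the constant gives the strict inequality from which a finite cover is extracted. *)
exists (2 * C); first by rewrite mulr_gt0.
move=> t x r rho Fx /andP[r0 rrho].
have q1 : 1 <= rho / r by rewrite ler_pdivlMr// mul1r ltW.
have qa0 : 0 < (rho / r) `^ a by rewrite powR_gt0// (lt_le_trans _ q1).
have [|s [sG Gs sK]] := @covering_number_lt _ _ r (2 * C * (rho / r) `^ a) (ball x rho `&` F).
  apply: le_lt_trans (HC x r rho Fx _) _; first by rewrite r0.
  rewrite lte_fin; have H := ler_powR q1 (ltW a'a).
  by apply: le_lt_trans (ler_wpM2l (ltW C0) H) _; rewrite ltr_pM2r// ltr_pMl// ltr1n.
have sF : [set` s] `<=` F by move=> y /sG[].
have sGr : ball x rho `&` F `<=` \bigcup_(x in [set` s]) ball x r.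
  by move=> y /Gs[z zs zy]; exists z => //; apply: le_ball zy; lra.
apply: ball_coverW (ball_cover_const t sF sGr) => //.
by rewrite ler_wpM2r ?powR_ge0// ltW.
Qed.

Definition scale_cover F (theta s delta K : R) : Prop :=
  ball_cover F (delta `^ theta^-1) delta s F K.

(* Balls of radius above [delta `^ gamma] are subdivided by the Assouad bound;
   those of radius below [rho = delta `^ (gamma / phi)] are replaced by balls
   of radius [rho], whose number is controlled by the content bound. *)
Lemma scale_cover_transfer F (theta phi a l s t gamma K : R) :
  totally_bounded_set F -> assouad_bound F a -> content_bound F l ->
  0 < theta -> theta <= phi -> phi <= 1 ->
  0 <= s -> l <= s -> s <= a -> s <= t ->
  1 <= gamma -> gamma * theta <= phi ->
  gamma * (a - t) <= a - s ->
  phi * (s - l) <= gamma * theta * (t - l) ->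
  exists delta1 K' : R, 0 < delta1 /\ forall delta, 0 < delta < delta1 ->
    scale_cover F theta s delta K -> scale_cover F phi t (delta `^ gamma) K'.
Proof.
move=> totF [C C0 HC] [c [rho1 [c0 rho10 Hc]]] th0 thph ph1 s0 ls sa st ga1 gath
  Hbig Hsmall.
have ph0 : 0 < phi by exact: lt_le_trans thph.
exists (Num.min 1 rho1), ((2 `^ t + C * 2 `^ a) * K + C * 4 `^ a / c * K).
split=> [|delta /andP[d0]]; first by rewrite lt_min ltr01.
rewrite lt_min => /andP[d1 drho1] [L [LF Lcov LK]].
have d01 : 0 < delta <= 1 by rewrite d0 ltW.
set eta := delta `^ gamma.
have eta0 : 0 < eta by exact: powR_gt0.
have etad : eta <= delta.
  by rewrite -[leRHS]powRr1 ?(ltW d0)//; exact: powR_le_exp.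
have eta01 : 0 < eta <= 1 by rewrite eta0 (le_trans etad)// ltW.
rewrite /scale_cover; set rho := eta `^ phi^-1.
have rho0 : 0 < rho by exact: powR_gt0.
have rhoeta : rho <= eta.
  rewrite -[leRHS]powRr1 ?(ltW eta0)//; apply: powR_le_exp => //.
  by rewrite invr_ge1// ?unitf_gt0.
have rhoE : rho = delta `^ (gamma / phi) by rewrite /rho /eta -powRrM.
set lo := delta `^ theta^-1 in LF.
have lo0 : 0 < lo by exact: powR_gt0.
pose big := [seq p <- L | rho <= p.2].
pose small := [seq p <- L | p.2 < rho].
(* A ball of radius [rho] about a point of [G] meets no ball of [big], so small balls alone cover
   its part of [F] and the content bound applies to them. The excluded points of [F] lie in the
   doubled large balls, since [rho <= p.2] there. *)
pose G := [set x | F x /\ forall p, p \in big -> ~ ball p.1 (p.2 + rho) x].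
have [||Z [uZ ZG Zsep Zcov]] := @separated_net _ _ F G (4 * rho) totF.
- by move=> x [].
- by rewrite mulr_gt0.
have coverbig p : p \in big -> ball_cover F rho eta t
    (ball p.1 (2 * p.2) `&` F) ((2 `^ t + C * 2 `^ a) * p.2 `^ s).
  rewrite mem_filter => /andP[rhop pL]; have [Fp /andP[lop pd]] := LF _ pL.
  have p0 : 0 < p.2 by exact: lt_le_trans lop.
  have ps0 : 0 <= p.2 `^ s by exact: powR_ge0.
  have [peta|etap] := leP (2 * p.2) eta.
    exists [:: (p.1, 2 * p.2)]; split.
    + by move=> q; rewrite inE => /eqP ->/=; split => //; apply/andP; split; lra.
    + by move=> x [px _]; exists (p.1, 2 * p.2); rewrite ?inE.
    + rewrite big_seq1/= powR_mul// mulrDl.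
      have : p.2 `^ t <= p.2 `^ s.
        by apply: powR_le_exp => //; rewrite p0 (le_trans pd)// ltW.
      have : 0 < (2:R) `^ t by rewrite powR_gt0.
      have : 0 <= C * 2 `^ a * p.2 `^ s.
        by rewrite !mulr_ge0// ?powR_ge0// ltW.
      nra.
  apply: ball_coverW (HC t p.1 eta (2 * p.2) Fp _) => //; last by rewrite eta0.
  apply: (@le_trans _ _ (C * 2 `^ a * p.2 `^ s)); last first.
    by rewrite mulrDl lerDr mulr_ge0// powR_ge0.
  rewrite powR_div ?mulr_gt0// powR_mul//.
  have -> : p.2 `^ a = p.2 `^ s * p.2 `^ (a - s).
    by rewrite -powR_add//; congr (_ `^ _); ring.
  have -> : C * (2 `^ a * (p.2 `^ s * p.2 `^ (a - s)) / eta `^ a) * eta `^ t =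
      C * 2 `^ a * p.2 `^ s * (p.2 `^ (a - s) * eta `^ (t - a)).
    by rewrite [eta `^ (t - a)]powR_sub//; field; rewrite gt_eqF// powR_gt0.
  rewrite ler_piMr ?mulr_ge0 ?powR_ge0 ?(ltW C0)//.
  have pas : p.2 `^ (a - s) <= delta `^ (a - s).
    by apply: powR_le_base; rewrite ?subr_ge0// ltW.
  have H0 : 0 <= eta `^ (t - a) by exact: powR_ge0.
  apply: le_trans (ler_wpM2r H0 pas) _.
  (* The exponent [(a - s) - gamma * (a - t)] of [delta] is nonnegative by [Hbig]. *)
  rewrite -powRrM -powR_add// -(powRr0 delta); apply: powR_le_exp => //; nra.
(* The radius [4 * rho] may exceed [eta], as it does for [phi = 1], so these balls are subdivided
   once more. *)
have coverZ z : z \in Z -> ball_cover F rho eta t (ball z (4 * rho) `&` F)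
    (C * 4 `^ a * rho `^ t).
  move=> /ZG[Fz _]; apply: ball_coverW (HC t z rho (4 * rho) Fz _) => //.
    by rewrite mulfK ?gt_eqF.
  by rewrite rho0/=; lra.
(* The content bounds are summed over [Z] without counting a small ball twice. As radii are at least
   [lo] and [l <= s], passing from exponent [s] to [l] costs at most the factor [lo^(l - s)]. *)
have sizeZ : (size Z)%:R * (c * rho `^ l) <= lo `^ (l - s) * K.
  have smallL p : p \in small -> p \in L /\ p.2 < rho.
    by rewrite mem_filter => /andP[].
  apply: (@le_trans _ _ (\sum_(p <- small) p.2 `^ l)).
    apply: (separated_sum uZ Zsep) => [p /smallL[_ /ltW]//|p|z zZ].
      exact: powR_ge0.
    have [Fz zbig] := ZG _ zZ; rewrite -big_filter; apply: (Hc z) => //.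
    - by rewrite rho0/= (le_trans rhoeta)// (le_trans etad)// ltW.
    - move=> p; rewrite mem_filter => /andP[_ /smallL[/LF[_ /andP[lop _]] /ltW ->]].
      by rewrite (lt_le_trans lo0).
    - move=> u zu Fu; have [p pL pu] := Lcov u Fu.
      exists p => //; rewrite !mem_filter pL andbT; apply/andP; split.
        by apply/asboolP; exists u.
      rewrite ltNge; apply/negP => rhop; apply: (zbig p).
        by rewrite mem_filter rhop.
      exact: ball_triangle pu (ball_sym zu).
  have H0 : 0 <= lo `^ (l - s) by exact: powR_ge0.
  apply: le_trans (ler_wpM2l H0 LK); rewrite mulr_sumr big_filter.
  rewrite big_mkcond/=; apply: le_sum_seq => p pL _.
  have [_ /andP[lop _]] := LF _ pL; have p0 : 0 < p.2 by exact: lt_le_trans lop.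
  case: ifPn => _; last by rewrite mulr_ge0// powR_ge0.
  have -> : p.2 `^ l = p.2 `^ (l - s) * p.2 `^ s.
    by rewrite -powR_add//; congr (_ `^ _); ring.
  rewrite ler_wpM2r ?powR_ge0//; apply: powR_ge_base => //; lra.
have K0 : 0 <= K by apply: le_trans LK; apply: sumr_ge0 => *; exact: powR_ge0.
have := ball_coverU (ball_cover_bigcup coverbig) (ball_cover_bigcup coverZ).
apply: ball_coverW => //.
- move=> x Fx; have [[p pbig px]|nop] := pselect (exists2 p, p \in big & ball p.1 (p.2 + rho) x).
    left; exists p => //; split => //; apply: le_ball px.
    by move: pbig; rewrite mem_filter => /andP[rhop _]; lra.
  have [|z zZ zx] := Zcov x; last by right; exists z.
  by split => // p pbig px; apply: nop; exists p.
- apply: lerD.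
    rewrite -mulr_sumr; apply: ler_wpM2l.
      by rewrite addr_ge0 ?mulr_ge0 ?powR_ge0// ltW.
    apply: le_trans LK; rewrite big_filter big_mkcond.
    by apply: le_sum_seq => p _ _; case: ifP => // _; exact: powR_ge0.
  rewrite big_const_seq count_predT iter_addr_0.
  have -> : C * 4 `^ a * rho `^ t *+ size Z =
      C * 4 `^ a / c * (rho `^ (t - l) * ((size Z)%:R * (c * rho `^ l))).
    have -> : rho `^ t = rho `^ (t - l) * rho `^ l.
      by rewrite -powR_add//; congr (_ `^ _); ring.
    by rewrite -mulr_natr; field; rewrite gt_eqF.
  apply: ler_wpM2l.
    by rewrite !mulr_ge0 ?invr_ge0 ?powR_ge0// ltW.
  apply: le_trans (ler_wpM2l (powR_ge0 _ _) sizeZ) _.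
  rewrite mulrA ler_piMl// rhoE /lo -!powRrM -powR_add// -(powRr0 delta).
  apply: powR_le_exp => //.
  (* The numerator is nonnegative by [Hsmall]. *)
  have -> : gamma / phi * (t - l) + theta^-1 * (l - s) =
     (gamma * theta * (t - l) - phi * (s - l)) / (phi * theta).
    by field; rewrite !gt_eqF.
  by rewrite divr_ge0 ?mulr_ge0 ?subr_ge0// ltW.
Qed.

End transfer.

(** * Limits at small scales *)

Section small_scales.
Context {R : realType}.

(** The quantifier over scales behind an upper ([true]) or lower ([false]) limit; carrying it as a
    boolean lets one proof serve both families of dimensions. *)
Definition small_scales (b : bool) (P : R -> Prop) : Prop :=
  if b then exists2 e, 0 < e & forall d, 0 < d < e -> P d
  else forall e, 0 < e -> exists2 d, 0 < d < e & P d.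

(** The change of scale [k * d^g] is an increasing bijection of the positive reals tending to 0 at
    0, so it preserves both kinds of quantifier. *)
Lemma small_scales_map b (P Q : R -> Prop) (k g e : R) :
  0 < k -> 0 < g -> 0 < e ->
  (forall d, 0 < d < e -> P d -> Q (k * d `^ g)) ->
  small_scales b P -> small_scales b Q.
Proof.
move=> k0 g0 e0 PQ.
have mono x y : 0 <= x -> x < y -> x `^ g < y `^ g.
  by move=> x0 xy; apply: gt0_ltr_powR => //; rewrite nnegrE// (le_trans x0)// ltW.
have inv y : 0 < y -> exists2 x, 0 < x & k * x `^ g = y.
  move=> y0; exists ((y / k) `^ g^-1); first by rewrite powR_gt0// divr_gt0.
  rewrite powR_inv_cancel ?gt_eqF//; last by rewrite divr_ge0// ltW.
  by rewrite mulrC divfK// gt_eqF.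
have reflect x y : 0 < x -> 0 < y -> k * x `^ g < k * y `^ g -> x < y.
  move=> x0 y0; rewrite ltr_pM2l// => xy; rewrite ltNge; apply/negP => yx.
  by move: xy; rewrite ltNge powR_le_base// ltW.
case: b => /= [[e' e'0 Pe']|H eta eta0].
  have m0 : 0 < Num.min e e' by rewrite lt_min e0.
  exists (k * (Num.min e e') `^ g) => [|y /andP[y0]].
    by rewrite mulr_gt0// powR_gt0.
  have [x x0 <-] := inv y y0 => /(reflect _ _ x0 m0); rewrite lt_min => /andP[xe xe'].
  by apply: PQ; [rewrite x0|apply: Pe'; rewrite x0].
have [x x0 xeta] := inv eta eta0.
have [|d /andP[d0]] := H (Num.min e x); first by rewrite lt_min e0.
rewrite lt_min => /andP[de dx] Pd; exists (k * d `^ g); last by apply: PQ; rewrite ?d0.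
by rewrite mulr_gt0 ?powR_gt0//= -xeta ltr_pM2l// mono// ltW.
Qed.

Lemma small_scales_imp b (P Q : R -> Prop) (e : R) : 0 < e ->
  (forall d, 0 < d < e -> P d -> Q d) -> small_scales b P -> small_scales b Q.
Proof.
move=> e0 PQ; apply: (@small_scales_map _ P Q 1 1 e) => // d /andP[d0 de] Pd.
by rewrite mul1r powRr1 ?(ltW d0)//; apply: PQ; rewrite ?d0.
Qed.

Lemma small_scales_ex b (P : R -> Prop) (e : R) : 0 < e ->
  small_scales b P -> exists2 d, 0 < d < e & P d.
Proof.
case: b => [e0 [e' e'0 Pe']|e0 /(_ e e0)//].
have m0 : 0 < Num.min e e' by rewrite lt_min e0.
have me : Num.min e e' <= e by rewrite ge_min lexx.
have me' : Num.min e e' <= e' by rewrite ge_min lexx orbT.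
by exists (Num.min e e' / 2); [|apply: Pe']; apply/andP; split; lra.
Qed.

Lemma at_right0E (V : set R) :
  (0 : R)^'+ V <-> small_scales true V.
Proof.
split=> [[e /= e0 H]|[e e0 H]].
  exists e => // d /andP[d0 de]; apply: H => //=.
  by rewrite sub0r normrN gtr0_norm.
near=> d; apply: H; apply/andP; split; near: d.
  exact: nbhs_right_gt.
exact: nbhs_right_lt.
Unshelve. all: by end_near. Qed.

Definition limf_small (b : bool) (f : R -> \bar R) : \bar R :=
  if b then limf_esup f (0 : R)^'+ else limf_einf f (0 : R)^'+.

Lemma limf_small_lt b (f : R -> \bar R) (s : \bar R) : (limf_small b f < s)%E ->
  small_scales b (fun d => (f d < s)%E).
Proof.
case: b => /=.
  move=> /ereal_inf_lt[_ [V /at_right0E[e e0 H] <-]] fs; exists e => // d /H Vd.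
  by apply: le_lt_trans fs; apply: ereal_sup_ubound; exists d.
rewrite limf_einfE => fs e e0.
have /ereal_inf_lt[_ [d de <-] fd] :
    (ereal_inf (f @` [set d | (0 < d < e)%R]) < s)%E.
  apply: le_lt_trans fs; apply: ereal_sup_ubound.
  by exists [set d | (0 < d < e)%R] => //; apply/at_right0E; exists e.
by exists d.
Qed.

Lemma limf_small_le b (f : R -> \bar R) (s : \bar R) :
  small_scales b (fun d => (f d <= s)%E) -> (limf_small b f <= s)%E.
Proof.
case: b => /= [fs|fs].
  apply: le_trans (_ : ereal_sup (f @` [set d | (f d <= s)%E]) <= _)%E.
    by apply: ereal_inf_lbound; exists [set d | (f d <= s)%E] => //; apply/at_right0E.
  by apply: ge_ereal_sup => _ [d fd <-].
rewrite limf_einfE; apply: ge_ereal_sup => _ [V /at_right0E[e e0 H] <-].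
have [d /H Vd fd] := fs e e0.
by apply: le_trans fd; apply: ereal_inf_lbound; exists d.
Qed.

End small_scales.

(** * Comparison with the covers defining the intermediate dimensions *)

Section covers.
Context {R : realType} {X : metricType R}.
Implicit Types (F U : set X) (theta s t : R).

Lemma mdist_le_diam U (x y : X) : U x -> U y -> ((mdist x y)%:E <= diam U)%E.
Proof. by move=> Ux Uy; apply: ereal_sup_ubound; right; exists x => //; exists y. Qed.

Lemma diam_le U (M : R) : 0 <= M ->
  (forall x y, U x -> U y -> mdist x y <= M) -> (diam U <= M%:E)%E.
Proof.
move=> M0 H; apply: ge_ereal_sup => _ [->|[x Ux [y Uy <-]]]; rewrite lee_fin//.
exact: H.
Qed.

(* The lower bound on the diameters bounds the number of sets by the sum. *)
Lemma esum_finite (D : set nat) (f : nat -> \bar R) (k M : R) : 0 < k ->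
  (forall i, D i -> k%:E <= f i)%E -> (\esum_(i in D) f i <= M%:E)%E ->
  finite_set D.
Proof.
move=> k0 kf fM; apply: contrapT => infD.
have [B BD Bn] := infinite_set_fset (Num.bound (M / k)) infD.
pose r := finmap.enum_fset B.
have rD : [set` r] `<=` D by move=> i ir; exact: BD.
have kB : (\sum_(i <- r) k%:E <= \esum_(i in D) f i)%E.
  apply: esum_ge; exists [set` r]; first by split => //; exact: finite_seq.
  rewrite -fsbig_seq ?finmap.fset_uniq//.
  rewrite big_seq [leRHS]big_seq; apply: lee_sum => i ir; apply: kf; exact: rD.
have := le_trans kB fM; rewrite sumEFin lee_fin big_const_seq count_predT iter_addr_0.
apply/negP; rewrite -ltNge -mulr_natl -ltr_pdivrMr//.
have [M0|M0] := leP 0 M.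
  apply: lt_le_trans (archi_boundP _) _; first by rewrite divr_ge0// ltW.
  by rewrite ler_nat.
by apply: lt_le_trans (ler0n _ _); rewrite pmulr_llt0 ?invr_gt0.
Qed.

(** A set of diameter [r] meeting [F] at [x] lies in the open ball of radius [2 * r] about [x],
    whence the scale [2 * delta]. Raising the radius to the new lower limit [(2 * delta)^(1/theta)]
    keeps it at most [2^(1/theta) * r], which gives the constant. *)
Lemma admissible_scale_cover F theta s (delta : R) : 0 < theta <= 1 -> 0 <= s ->
  0 < delta < 2^-1 -> admissible_cover F theta s 1 delta ->
  scale_cover F theta s (2 * delta) (2 `^ (s / theta)).
Proof.
move=> /andP[th0 th1] s0 /andP[d0 d2] [D [U [FU Udelta Usum]]].
have thV : 1 <= theta^-1 by rewrite invr_ge1// unitf_gt0.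
set lo := delta `^ theta^-1 in Udelta.
have lo0 : 0 < lo by exact: powR_gt0.
have Ufin i : D i -> exists r, [/\ diam (U i) = r%:E, lo <= r & r <= delta].
  by move=> /Udelta; case: (diam (U i)) => [r||]; rewrite ?lee_fin ?leye_eq ?leeNy_eq ?andbF// => /andP[? ?]; exists r.
have finD : finite_set D.
  apply: esum_finite Usum; first exact: (powR_gt0 s lo0).
  move=> i /Ufin[r [-> lor _]]; rewrite poweR_EFin lee_fin.
  by apply: powR_le_base => //; exact: ltW.
have /finite_seqP[e0 De0] := finD.
pose e := undup e0.
have De : D = [set` e].
  by rewrite De0; apply/seteqP; split => i /=; rewrite mem_undup.
have eU i : i \in e -> ball_cover F ((2 * delta) `^ theta^-1) (2 * delta) s
    (U i `&` F) (2 `^ (s / theta) * fine (diam (U i)) `^ s).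
  move=> ie; have [|r [Ur lor rd]] := Ufin i; first by rewrite De.
  have r0 : 0 < r by exact: lt_le_trans lor.
  rewrite Ur/=.
  have [[x [Ux Fx]]|noUF] := pselect (U i `&` F !=set0); last first.
    exists [::]; split => // [x xUF|]; first by exfalso; apply: noUF; exists x.
    by rewrite big_nil mulr_ge0// powR_ge0.
  have two1 : 2 <= (2:R) `^ theta^-1 by apply: le1r_powR => //; lra.
  exists [:: (x, Num.max (2 * r) ((2 * delta) `^ theta^-1))]; split.
  - move=> p; rewrite inE => /eqP -> /=; split => //.
    rewrite le_max lexx orbT/= ge_max; apply/andP; split; first by lra.
    rewrite -[leRHS]powRr1; last by lra.
    by apply: powR_le_exp => //; apply/andP; split; lra.
  - move=> y [Uy _]; exists (x, Num.max (2 * r) ((2 * delta) `^ theta^-1)).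
      exact: mem_head.
    have := mdist_le_diam Ux Uy; rewrite Ur lee_fin => xy.
    by apply/ball_mdist => /=; rewrite lt_max; apply/orP; left; lra.
  - rewrite big_seq1/= [s / theta]mulrC powRrM -powR_mul ?powR_gt0//.
    apply: powR_le_base => //; first by rewrite le_max; apply/orP; left; lra.
    rewrite ge_max; apply/andP; split; first by rewrite ler_pM2r.
    by rewrite powR_mul// ler_pM2l// powR_gt0.
apply: ball_coverW (ball_cover_bigcup eU) => // [x Fx|].
  by have [i] := FU _ Fx; rewrite De => ie Ux; exists i.
rewrite -mulr_sumr ler_piMr ?powR_ge0// -lee_fin; apply: le_trans Usum.
apply: esum_ge; exists D; first by split.
rewrite De -fsbig_seq ?undup_uniq// -sumEFin big_seq [leRHS]big_seq.
apply: lee_sum => i ie; have [|r [-> _ _]] := Ufin i; first by rewrite De.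
by rewrite poweR_EFin.
Qed.

(** Uniform perfectness puts a point of each ball at distance at least [c] times the radius from the
    centre. Radii are raised to at least [b * lo / c] so that this distance reaches the lower limit
    [(2 * delta)^(1/theta)]; the cost grows by a constant factor, and there is room below [delta]
    because [theta < 1]. *)
Lemma scale_cover_admissible F theta s : uniformly_perfect X ->
  (0 < diam [set: X])%E -> 0 < theta < 1 -> 0 <= s ->
  exists M e : R, 0 < e /\ forall delta K, 0 < delta < e ->
    scale_cover F theta s delta K ->
    admissible_cover F theta s (M * K) (2 * delta).
Proof.
move=> [c /andP[c0 c1] HX] dX /andP[th0 th1] s0.
have [rho1 rho10 rho1X] : exists2 r : R, 0 < r & (r%:E < diam [set: X])%E.
  case: (diam [set: X]) dX => [r|_|//]; last by exists 1; rewrite ?ltry.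
  by rewrite lte_fin => r0; exists (r / 2); rewrite ?lte_fin; lra.
have thV : 1 < theta^-1 by rewrite invf_gt1.
have thV1 : 0 < theta^-1 - 1 by rewrite subr_gt0.
set b := (2:R) `^ theta^-1.
have b0 : 0 < b by rewrite powR_gt0.
have b1 : 1 <= b by rewrite -(powRr0 2); apply: ler_powR; lra.
pose e := Num.min rho1 ((c / b) `^ (theta^-1 - 1)^-1).
exists ((2 * (b / c)) `^ s), e; split; first by rewrite lt_min rho10 powR_gt0// divr_gt0.
move=> delta K /andP[d0]; rewrite lt_min => /andP[drho1 de] [L [LF Lcov LK]].
set lo := delta `^ theta^-1 in LF.
have lo0 : 0 < lo by exact: powR_gt0.
have lod : b * lo <= c * delta.
  have : delta `^ (theta^-1 - 1) <= c / b.
    rewrite -[leRHS](powR_inv_cancel _ (lt0r_neq0 thV1)) ?divr_ge0 ?(ltW c0) ?(ltW b0)//.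
    by apply: powR_le_base; rewrite ltW.
  rewrite powR_sub// powRr1 ?(ltW d0)// ler_pdivrMr// -/lo => H.
  by rewrite mulrC -ler_pdivlMr// mulrAC.
have lo2 : (2 * delta) `^ theta^-1 = b * lo by rewrite powR_mul.
pose r (p : X * R) := Num.max p.2 (b * lo / c).
have rE p : p \in L -> [/\ 0 < p.2, p.2 <= r p, r p <= delta, b * lo <= c * r p & r p <= b / c * p.2].
  move=> /LF[_ /andP[lop pd]].
  have p0 : 0 < p.2 by exact: lt_le_trans lop.
  split => //; rewrite /r ?le_max ?lexx// ?ge_max.
  - by rewrite pd/= ler_pdivrMr// (mulrC delta).
  - by rewrite -ler_pdivrMl// mulrC le_max lexx orbT.
  - rewrite ler_peMl ?(ltW p0)//=; last by rewrite ler_pdivlMr// mul1r; lra.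
    by rewrite mulrAC ler_pM2l// divr_gt0.
pose Us := [seq ball p.1 (r p) | p <- L].
have rdiam : forall p, p \in L ->
    ((b * lo)%:E <= diam (ball p.1 (r p)) <= (2 * r p)%:E)%E.
  move=> p pL; have [p0 pr rd rlo _] := rE _ pL.
  have r0 : 0 < r p by exact: lt_le_trans pr.
  apply/andP; split; last first.
    apply: diam_le => [|x y]; first by rewrite mulr_ge0// ltW.
    rewrite !ball_mdist; have := metric_triangle x p.1 y.
    rewrite (metric_sym x p.1); lra.
  have [|y [py npy]] := HX p.1 (r p) r0.
    by apply: lt_trans rho1X; rewrite lte_fin; lra.
  apply: le_trans (mdist_le_diam (ballxx p.1 r0) py); rewrite lee_fin.
  by apply: le_trans rlo _; rewrite leNgt; apply/negP => /ball_mdist.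
exists [set i | (i < size Us)%N], (nth set0 Us); split.
- move=> x /Lcov[p pL px]; exists (index p L); rewrite /= ?size_map ?index_mem//.
  rewrite (nth_map p) ?index_mem// nth_index//.
  by apply: le_ball px; have [] := rE _ pL.
- move=> i /(mem_nth set0)/mapP[p pL ->]; have [_ _ rd _ _] := rE _ pL.
  rewrite lo2; have /andP[-> pr]/= := rdiam _ pL.
  by apply: le_trans pr _; rewrite lee_fin; lra.
- have -> : [set i | (i < size Us)%N] = [set` iota 0 (size Us)].
    by apply/seteqP; split => i /=; rewrite mem_iota.
  rewrite esum_fset => [||i _]; [|exact: finite_seq|exact: poweR_ge0].
  rewrite -fsbig_seq ?iota_uniq//.
  have -> : (\sum_(i <- iota 0 (size Us)) diam (nth set0 Us i) `^ s =
      \sum_(p <- L) diam (ball p.1 (r p)) `^ s)%E.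
    by rewrite -(big_map (fun p => ball p.1 (r p)) predT (fun U => diam U `^ s)%E)
      (big_nth set0) /index_iota subn0.
  apply: (@le_trans _ _ (\sum_(p <- L) ((2 * (b / c)) `^ s * p.2 `^ s)%:E)%E).
    rewrite big_seq [leRHS]big_seq; apply: lee_sum => p pL.
    have [p0 pr rd rlo rb] := rE _ pL; have := rdiam _ pL.
    have blo0 : 0 < b * lo by rewrite mulr_gt0.
    case: (diam _) => [q||]; rewrite ?lee_fin ?leye_eq ?leeNy_eq ?andbF//.
    move=> /andP[q0 qr]; rewrite -powR_mul// ?mulr_gt0 ?invr_gt0//.
    by apply: powR_le_base => //; lra.
  by rewrite sumEFin lee_fin -mulr_sumr ler_wpM2l ?powR_ge0.
Qed.

End covers.

(** * Box dimensions as the endpoint [theta = 1] *)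

Section box.
Context {R : realType} {X : metricType R}.
Implicit Types (F : set X) (s t : R).

Lemma box_ratio_lt F s (delta : R) : 0 < delta < 1 ->
  (box_ratio F delta < s%:E)%E ->
  (covering_number delta F < (delta `^ (- s))%:E)%E.
Proof.
move=> /andP[d0 d1]; have ln0 : 0 < - ln delta by rewrite oppr_gt0 ln_lt0// d0.
rewrite /box_ratio; case: (covering_number delta F) => [r| |].
- have [r0 _|r0] := leP r 0.
    by rewrite lte_fin (le_lt_trans r0)// powR_gt0.
  rewrite lne_EFin// -EFinM !lte_fin ltr_pdivrMr// => H.
  by rewrite -ltr_ln ?posrE ?powR_gt0// ln_powR; lra.
- by rewrite /= gt0_mulye// lte_fin invr_gt0.
- by rewrite ltNyr.
Qed.

Lemma box_ratio_le F s (delta : R) : 0 < delta < 1 ->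
  (covering_number delta F <= (delta `^ (- s))%:E)%E ->
  (box_ratio F delta <= s%:E)%E.
Proof.
move=> /andP[d0 d1]; have ln0 : 0 < - ln delta by rewrite oppr_gt0 ln_lt0// d0.
have NyM : (-oo * (- ln delta)^-1%:E = -oo)%E.
  by rewrite gt0_mulNye// lte_fin invr_gt0.
rewrite /box_ratio; case: (covering_number delta F) => [r| |].
- have [r0 _|r0] := leP r 0.
    by rewrite le0_lneNy ?lee_fin// NyM leNye.
  rewrite lne_EFin// -EFinM !lee_fin ler_pdivrMr// => H.
  have := H; rewrite -ler_ln ?posrE ?powR_gt0// ln_powR; lra.
- by rewrite leye_eq.
- by rewrite le0_lneNy ?leNye// NyM leNye.
Qed.

(** At [theta = 1] the window of radii is a single value; the halved scale is the radius used by
    [covering_number]. *)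
Lemma box_ratio_scale_cover F s (delta : R) : 0 < delta < 1 ->
  (box_ratio F delta < s%:E)%E ->
  scale_cover F 1 s (delta / 2) (2 `^ (- s)).
Proof.
move=> d01 /(box_ratio_lt d01)/covering_number_lt[x [xF Fx sizex]].
have /andP[d0 d1] := d01; have d20 : 0 < delta / 2 by rewrite divr_gt0.
apply: ball_coverW (ball_cover_const s xF Fx) => //.
  by rewrite invr1 powRr1 ?(ltW d20).
apply: le_trans (ler_wpM2r (powR_ge0 _ _) (ltW sizex)) _.
by rewrite powR_div// !powRN mulrA mulVf ?mul1r// gt_eqF// powR_gt0.
Qed.

(** The count is at most a constant times [delta^(-s)], and the gap [t - s] absorbs the constant and
    the change of scale once [delta] is small. *)
Lemma scale_cover_box_ratio F s t (K : R) : s < t ->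
  exists2 e : R, 0 < e & forall delta, 0 < delta < e ->
    scale_cover F 1 s delta K -> (box_ratio F (2 * delta) <= t%:E)%E.
Proof.
move=> st; pose K1 := Num.max 1 K.
have K10 : 0 < K1 by rewrite lt_max ltr01.
have ts0 : 0 < t - s by rewrite subr_gt0.
pose A := (K1 * 2 `^ t)^-1.
have A0 : 0 < A by rewrite invr_gt0 mulr_gt0// powR_gt0.
exists (Num.min (2^-1) (A `^ (t - s)^-1)).
  by rewrite lt_min invr_gt0 ltr0n powR_gt0.
move=> delta /andP[d0]; rewrite lt_min => /andP[d2 dA] [L [LF Lcov LK]].
apply: box_ratio_le; first by apply/andP; split; lra.
have Lr p : p \in L -> p.2 = delta.
  by move=> /LF[_]; rewrite invr1 powRr1 ?(ltW d0)// -eq_le => /eqP.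
have := @covering_number_le_size R X (2 * delta) F [seq p.1 | p <- L].
rewrite size_map => /(_ _ _)/le_trans; apply => //.
- by move=> x /mapP[p /LF[Fp _] ->].
- move=> x /Lcov[p pL px]; exists p.1; first exact: map_f.
  by rewrite [2 * delta]mulrC mulfK// -(Lr _ pL).
rewrite lee_fin.
have ds : 0 < delta `^ s by rewrite powR_gt0.
have LKd : (size L)%:R * delta `^ s <= K1.
  rewrite le_max; apply/orP; right; apply: le_trans LK.
  rewrite big_seq (eq_bigr (fun=> delta `^ s)); last by move=> p /Lr ->.
  by rewrite -big_seq big_const_seq count_predT iter_addr_0 mulr_natl.
have dts : delta `^ t <= A * delta `^ s.
  rewrite -ler_pdivrMr// -powR_sub// -[leRHS](powR_inv_cancel (ltW A0) (lt0r_neq0 ts0)).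
  by apply: powR_le_base; rewrite ltW.
have t2 : 0 < (2:R) `^ t by rewrite powR_gt0.
have dt : 0 < delta `^ t by rewrite powR_gt0.
rewrite powRN powR_mul// -[leRHS]mul1r ler_pdivlMr ?mulr_gt0//.
have : (size L)%:R * (2 `^ t * delta `^ t) <= (size L)%:R * (2 `^ t * (A * delta `^ s)).
  by rewrite ler_wpM2l// ler_pM2l.
move=> /le_trans; apply.
have -> : (size L)%:R * (2 `^ t * (A * delta `^ s)) = (size L)%:R * delta `^ s / K1.
  by rewrite /A; field; rewrite !gt_eqF.
by rewrite ler_pdivrMr// mul1r.
Qed.

End box.

(** * Intermediate dimensions as thresholds for bounded sums *)

Section interdim.
Context {R : realType} {X : metricType R}.
Implicit Types (F : set X) (theta s t : R) (b : bool).

Definition intermediate_dim b theta F : \bar R :=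
  if b then upper_intermediate_dim theta F else lower_intermediate_dim theta F.

Definition covered_at b F theta s : Prop :=
  exists K, small_scales b (fun delta => scale_cover F theta s delta K).

(** All radii are at most [delta], so each term gains the factor [delta^(t - s)]. This links the
    bounded sums of [covered_at] to definitions with arbitrarily small [eps]. *)
Lemma scale_cover_exp F theta s t (delta K : R) : s <= t -> 0 < delta <= 1 ->
  scale_cover F theta s delta K -> scale_cover F theta t delta (delta `^ (t - s) * K).
Proof.
move=> st /andP[d0 d1] [L [LF Lcov LK]]; exists L; split => //.
apply: le_trans (ler_wpM2l (powR_ge0 _ _) LK); rewrite mulr_sumr.
apply: le_sum_seq => p pL _; have [_ /andP[lop pd]] := LF _ pL.
have p0 : 0 < p.2 by apply: lt_le_trans lop; exact: powR_gt0.
have -> : p.2 `^ t = p.2 `^ (t - s) * p.2 `^ s.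
  by rewrite -powR_add//; congr (_ `^ _); ring.
by rewrite ler_wpM2r ?powR_ge0// powR_le_base ?subr_ge0// ltW.
Qed.

Lemma scale_cover_K_ge0 F theta s (delta K : R) : scale_cover F theta s delta K -> 0 <= K.
Proof. by move=> [L [_ _]]; apply: le_trans; apply: sumr_ge0 => *; exact: powR_ge0. Qed.

Lemma covered_at_exp b F theta s t : s <= t ->
  covered_at b F theta s -> covered_at b F theta t.
Proof.
move=> st [K HK]; exists K; move: HK; apply: (@small_scales_imp _ _ _ _ 1) => //.
move=> d /andP[d0 d1] H; have K0 := scale_cover_K_ge0 H.
apply: ball_coverW (scale_cover_exp st _ H) => //; last by rewrite d0 ltW.
rewrite ler_piMl// -(powRr0 d); apply: powR_le_exp; last by rewrite subr_ge0.
by rewrite d0 ltW.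
Qed.

Lemma covered_at_theta b F theta phi s : 0 < theta -> theta <= phi ->
  covered_at b F phi s -> covered_at b F theta s.
Proof.
move=> th0 thph [K H]; exists K; move: H; apply: (@small_scales_imp _ _ _ _ 1) => //.
move=> d /andP[d0 d1]; apply: ball_coverW => //.
apply: powR_le_exp; first by rewrite d0 ltW.
by rewrite lef_pV2 ?posrE// (lt_le_trans th0).
Qed.

Lemma intermediate_dim1 b F : intermediate_dim b 1 F = limf_small b (box_ratio F).
Proof.
by case: b; rewrite /= /upper_intermediate_dim /lower_intermediate_dim eqxx.
Qed.

Lemma intermediate_dim_ne1 b theta F : theta != 1 -> intermediate_dim b theta F =
  ereal_inf [set s%:E | s in [set s : R | 0 <= s /\ forall eps : R, 0 < eps ->
    small_scales b (admissible_cover F theta s eps)]].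
Proof.
move=> th1; rewrite /intermediate_dim /upper_intermediate_dim /lower_intermediate_dim.
rewrite (negbTE th1); case: b; congr ereal_inf; apply/seteqP; split;
  move=> _ [s [s0 H] <-]; exists s => //; split => //.
- by move=> eps /H[e /andP[e0 _] He]; exists e.
- move=> eps /H[e e0 He]; exists (Num.min e 1).
    by rewrite lt_min e0 ltr01/= ge_min lexx orbT.
  by move=> d /andP[d0]; rewrite lt_min => /andP[de _]; apply: He; rewrite d0.
- move=> eps eps0 e e0.
  have [|d /andP[d0]] := H eps (Num.min e 1) eps0.
    by rewrite lt_min e0 ltr01/= ge_min lexx orbT.
  by rewrite lt_min => /andP[de _] Hd; exists d; rewrite ?d0.
- by move=> eps e eps0 /andP[e0 _]; exact: H.
Qed.

Lemma intermediate_dim_covered b F theta s : 0 < theta <= 1 ->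
  (intermediate_dim b theta F < s%:E)%E -> covered_at b F theta s.
Proof.
move=> /andP[th0 th1]; have [->|thn1] := eqVneq theta 1.
  rewrite intermediate_dim1 => /limf_small_lt H; exists (2 `^ (- s)); move: H.
  apply: (@small_scales_map _ _ _ _ (2^-1) 1 1) => // d /andP[d0 d1] H.
  rewrite powRr1 ?(ltW d0)// mulrC; apply: box_ratio_scale_cover => //.
  by rewrite d0.
rewrite intermediate_dim_ne1// => /ereal_inf_lt[_ [s' [s'0 H] <-]].
rewrite lte_fin => /ltW; move/covered_at_exp; apply.
exists (2 `^ (s' / theta)); move: (H 1 ltr01).
apply: (@small_scales_map _ _ _ _ 2 1 (2^-1)) => // d d01 Hd.
rewrite powRr1; last by have /andP[/ltW] := d01.
by apply: admissible_scale_cover => //; rewrite th0.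
Qed.

Lemma covered_intermediate_dim b F theta s : uniformly_perfect X ->
  (0 < diam [set: X])%E -> 0 < theta <= 1 -> 0 <= s ->
  covered_at b F theta s -> (intermediate_dim b theta F <= s%:E)%E.
Proof.
move=> upX dX /andP[th0 th1] s0 [K HK].
apply/lee_addgt0Pr => eta eta0; rewrite -EFinD; set t := s + eta.
have st : s < t by rewrite ltrDl.
have t0 : 0 <= t by exact: le_trans (ltW st).
have [thE|thn1] := eqVneq theta 1.
  rewrite thE intermediate_dim1; rewrite thE in HK; apply: limf_small_le.
  have [e e0 He] := @scale_cover_box_ratio R X F s t K st.
  move: HK; apply: (@small_scales_map _ _ _ _ 2 1 e) => // d /andP[d0 de] Hd.
  by rewrite powRr1 ?(ltW d0)//; apply: He; rewrite ?d0.
rewrite intermediate_dim_ne1//; apply: ereal_inf_lbound; exists t => //.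
split=> // eps eps0.
have [|M [e [e0 He]]] := @scale_cover_admissible R X F theta t upX dX _ t0.
  by rewrite th0 lt_neqAle thn1.
pose B := Num.max 1 (M * K).
have B0 : 0 < B by rewrite lt_max ltr01.
pose e1 := Num.min (Num.min 1 e) ((eps / B) `^ (t - s)^-1).
have ts0 : 0 < t - s by rewrite subr_gt0.
have eB0 : 0 < eps / B by rewrite divr_gt0.
move: HK; apply: (@small_scales_map _ _ _ _ 2 1 e1) => //.
  by rewrite !lt_min ltr01 e0 powR_gt0.
move=> d /andP[d0]; rewrite !lt_min => /andP[/andP[d1 de] dB] Hd.
rewrite powRr1 ?(ltW d0)//.
have d01 : 0 < d <= 1 by rewrite d0 ltW.
have [|D [U [FU Udiam Usum]]] := He d _ _ (scale_cover_exp (ltW st) d01 Hd).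
  by rewrite d0.
exists D, U; split => //; apply: le_trans Usum _; rewrite lee_fin.
have dp0 : 0 < d `^ (t - s) by rewrite powR_gt0.
have dp : d `^ (t - s) <= eps / B.
  rewrite -[leRHS](powR_inv_cancel (ltW eB0) (lt0r_neq0 ts0)).
  by apply: powR_le_base; rewrite ltW.
have MKB : M * K <= B by rewrite le_max lexx orbT.
rewrite ler_pdivlMr// in dp.
by rewrite mulrCA; apply: le_trans dp; rewrite ler_pM2l.
Qed.

End interdim.

(** * Bounds on the intermediate dimensions *)

Section bounds.
Context {R : realType} {X : metricType R}.
Implicit Types (F : set X) (theta s t : R) (b : bool).

(** If the diameter were 0, no positive radius would satisfy [rho <= diam F]; the condition defining
    the lower dimension would be vacuous and its supremum infinite. *)
Lemma diam_gt0_lower_dim F : (lower_dim F < +oo)%E -> (0 < diam F)%E.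
Proof.
move=> lF; rewrite ltNge; apply/negP => dF.
have lFl l : (l%:E <= lower_dim F)%E.
  apply: ereal_sup_ubound; exists l => //; exists 1 => // x r rho _ /andP[r0 rrho].
  by move=> /le_trans/(_ dF); rewrite lee_fin leNgt (lt_trans r0 rrho).
move: lF lFl; case: (lower_dim F) => [d _ /(_ (d + 1))|//|_ /(_ 0)].
  by rewrite lee_fin; lra.
by rewrite leeNy_eq.
Qed.

Lemma diamT_gt0 : (exists x y : X, x <> y) -> (0 < diam [set: X])%E.
Proof.
move=> [x [y /eqP xy]]; apply: lt_le_trans (mdist_le_diam (I : setT x) (I : setT y)).
by rewrite lte_fin mdist_gt0.
Qed.

(** For [s < l], raising the exponent to [l] would make the sums tend to 0, while the content of [F]
    in one fixed ball bounds them below. *)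
Lemma covered_ge_content b F theta s (l : R) : F !=set0 -> content_bound F l ->
  covered_at b F theta s -> l <= s.
Proof.
move=> [x Fx] [c [rho1 [c0 rho10 Hc]]] [K HK]; rewrite leNgt; apply/negP => sl.
have ls0 : 0 < l - s by rewrite subr_gt0.
pose K1 := Num.max 1 K.
have K10 : 0 < K1 by rewrite lt_max ltr01.
pose A := c * rho1 `^ l / K1.
have A0 : 0 < A by rewrite !mulr_gt0 ?invr_gt0 ?powR_gt0.
pose e := Num.min (Num.min 1 rho1) (A `^ (l - s)^-1).
have [|d /andP[d0]] := small_scales_ex (e := e) _ HK.
  by rewrite !lt_min ltr01 rho10 powR_gt0.
rewrite !lt_min => /andP[/andP[d1 drho1] dA] Hd.
have [|L [LF Lcov LK]] := scale_cover_exp (ltW sl) _ Hd; first by rewrite d0 ltW.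
have lo0 : 0 < d `^ theta^-1 by exact: powR_gt0.
have H : c * rho1 `^ l <= \sum_(p <- L) p.2 `^ l.
  apply: (Hc x) => // [|p /LF[_ /andP[lop pd]]|u _ Fu]; last exact: Lcov.
    by rewrite rho10/=.
  by rewrite (lt_le_trans lo0)//= (le_trans pd)// ltW.
have := le_trans H LK; apply/negP; rewrite -ltNge.
have K1K : K <= K1 by rewrite le_max lexx orbT.
apply: le_lt_trans (ler_wpM2l (powR_ge0 _ _) K1K) _.
rewrite -ltr_pdivlMr// -/A -[ltRHS](powR_inv_cancel (ltW A0) (lt0r_neq0 ls0)).
by apply: gt0_ltr_powR; rewrite ?nnegrE ?powR_ge0// ltW.
Qed.

(** [F] lies in a single ball, and subdividing it at exponent [a] costs [C * rho^a] at every scale: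
    the powers of [d] cancel. *)
Lemma covered_assouad b F theta (a : R) : F !=set0 -> totally_bounded_set F ->
  assouad_bound F a -> 0 < theta <= 1 -> covered_at b F theta a.
Proof.
move=> [x0 Fx0] totF [C C0 HC] /andP[th0 th1].
have [_ [xs [_ Fxs] _] _] := ereal_inf_lt (totF 2 (ltr0Sn _ _)).
pose rho := 1 + \sum_(y <- xs) mdist x0 y.
have Frho : F `<=` ball x0 rho.
  move=> y /Fxs[z zxs /ball_mdist zy]; apply/ball_mdist; rewrite /rho.
  have := le_sum_seq_mem (f := mdist x0) (fun j => mdist_ge0 _ _) zxs.
  have := metric_triangle x0 z y; rewrite divff// in zy; lra.
have rho1 : 1 <= rho by rewrite lerDl sumr_ge0// => *; exact: mdist_ge0.
have H d : 0 < d < 1 -> scale_cover F theta a d (C * rho `^ a).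
  move=> /andP[d0 d1]; have da : 0 < d `^ a by rewrite powR_gt0.
  apply: ball_coverW (HC a x0 d rho Fx0 _).
  - rewrite -[leRHS]powRr1 ?(ltW d0)//; apply: powR_le_exp; first by rewrite d0 ltW.
    by rewrite invr_ge1// unitf_gt0.
  - exact: lexx.
  - by move=> y Fy; split => //; exact: Frho.
  - rewrite powR_div//; last by lra.
    by rewrite mulrA divfK// gt_eqF.
  - by rewrite d0/=; lra.
exists (C * rho `^ a); case: b => [|e e0]; first by exists 1.
have m0 : 0 < Num.min e 1 by rewrite lt_min e0 ltr01.
have me : Num.min e 1 <= e by rewrite ge_min lexx.
have m1 : Num.min e 1 <= 1 by rewrite ge_min lexx orbT.
by exists (Num.min e 1 / 2); [|apply: H]; apply/andP; split; lra.
Qed.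

(** The two fractions differ by exactly [h * theta * A^2 / (D * D0)], and both [D] and [D0] are at
    least [theta * A]. This controls the error from exponents that only approximate the
    dimensions. *)
Lemma parallel_sum_le (theta phi A B h : R) : 0 < theta -> 0 < phi -> 0 <= A ->
  0 <= B -> 0 < A + B -> 0 < h ->
  A * (B + h) / (theta * A + phi * (B + h)) <=
  B * A / (phi * B + theta * A) + h / theta.
Proof.
move=> th0 ph0 A0 B0 AB h0.
have thA : 0 <= theta * A by rewrite mulr_ge0// ltW.
have phB : 0 <= phi * B by rewrite mulr_ge0// ltW.
have phh : 0 < phi * h by rewrite mulr_gt0.
set D0 := phi * B + theta * A; set D := theta * A + phi * (B + h).
have D00 : 0 < D0.
  rewrite /D0; have [A0'|A0'] := ltP 0 A.
    by rewrite ltr_wpDl// mulr_gt0.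
  by rewrite ltr_pwDl// mulr_gt0//; lra.
have DD0 : 0 < D by rewrite /D mulrDr; lra.
rewrite -subr_ge0.
have -> : B * A / D0 + h / theta - A * (B + h) / D =
    h * (D * D0 - (theta * A) * (theta * A)) / (theta * D * D0).
  by rewrite /D /D0; field; rewrite -/D0 -/D !gt_eqF.
apply: divr_ge0; last by rewrite !mulr_ge0// ltW.
rewrite mulr_ge0 ?(ltW h0)// subr_ge0; apply: ler_pM => //; rewrite /D /D0 ?mulrDr; lra.
Qed.

End bounds.

(** * The comparison estimate, Lipschitz bound and continuity *)

Section intermediate_dim_bounds.
Context {R : realType} {X : metricType R} (F : set X) (dL dA : R).
Context (upX : uniformly_perfect X) (dX : (0 < diam [set: X])%E)
  (F0 : F !=set0) (totF : totally_bounded_set F)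
  (lowerF : lower_dim F = dL%:E) (assouadF : assouad_dim F = dA%:E)
  (dL0 : 0 <= dL) (dLA : dL < dA).
Implicit Types (theta phi s t : R) (b : bool).

Let contentF (l : R) : l < dL -> content_bound F l.
Proof.
move=> ll; apply: lower_dim_content => //; last by rewrite lowerF lte_fin.
by apply: diam_gt0_lower_dim; rewrite lowerF ltry.
Qed.

Let assouadbF (a : R) : dA < a -> assouad_bound F a.
Proof. by move=> aa; apply: assouad_dim_bound; rewrite assouadF lte_fin. Qed.

Let covered_ge_lower b theta s : covered_at b F theta s -> dL <= s.
Proof.
move=> Fs; rewrite leNgt; apply/negP => sL.
have := covered_ge_content F0 (contentF (l := (s + dL) / 2) _) Fs.
move=> H; have : (s + dL) / 2 <= s by apply: H; lra.
lra.
Qed.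

(** Replaces the infimum by a finite threshold for [covered_at], the form in which covers at two
    parameters can be compared. *)
Lemma intermediate_dimP b theta : 0 < theta <= 1 -> exists d : R,
  [/\ intermediate_dim b theta F = d%:E, dL <= d <= dA,
      forall s, d < s -> covered_at b F theta s
    & forall s, covered_at b F theta s -> d <= s].
Proof.
move=> th01; set D := intermediate_dim b theta F.
have Dlt s : (D < s%:E)%E -> covered_at b F theta s.
  exact: intermediate_dim_covered.
have Dle s : covered_at b F theta s -> (D <= s%:E)%E.
  move=> Fs; apply: covered_intermediate_dim => //.
  exact: le_trans (covered_ge_lower Fs).
have DA : (D <= dA%:E)%E.
  apply/lee_addgt0Pr => e e0; rewrite -EFinD; apply: Dle.
  by apply: covered_assouad => //; apply: assouadbF; rewrite ltrDl.
have DL : (dL%:E <= D)%E.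
  rewrite leNgt; apply/negP => DL.
  have [s [Ds sL]] : exists s, (D < s%:E)%E /\ s < dL.
    case: (D) DL => [d| |_].
    - by rewrite lte_fin => dd; exists ((d + dL) / 2); rewrite lte_fin; split; lra.
    - by rewrite ltNge leey.
    - by exists (dL - 1); split; [exact: ltNyr|lra].
  by have := covered_ge_lower (Dlt _ Ds); rewrite leNgt sL.
have : D \is a fin_num.
  by rewrite fin_numE; apply/andP; split; apply/eqP => DE; move: DA DL; rewrite DE.
move=> /fineK DE; exists (fine D); split => // [|s|s].
- by rewrite -lee_fin DE DL -lee_fin DE.
- by rewrite -lte_fin DE; exact: Dlt.
- by rewrite -lee_fin DE; exact: Dle.
Qed.

(** The left inequality holds because a larger parameter narrows the window of radii. For the right
    one, none of the three dimensions need be attained as an exponent, so each is shifted by [e],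
    which tends to 0 at the end. *)
Lemma intermediate_dim_bound b theta phi (d d' : R) :
  0 < theta -> theta <= phi -> phi <= 1 ->
  intermediate_dim b theta F = d%:E -> intermediate_dim b phi F = d'%:E ->
  d <= d' <= d + (d - dL) * (dA - d) / (phi * (d - dL) + theta * (dA - d))
                 * (phi - theta).
Proof.
move=> th0 thph ph1 dE d'E.
have ph0 : 0 < phi by exact: lt_le_trans thph.
have [|? []] := intermediate_dimP b (theta := theta).
  by rewrite th0 (le_trans thph).
rewrite dE => -[<-] /andP[dLd ddA] dcov covd.
have [|? []] := intermediate_dimP b (theta := phi); first by rewrite ph0.
rewrite d'E => -[<-] _ d'cov covd'.
apply/andP; split.
  apply/ler_addgt0Pr => e e0; apply: covd; apply: (covered_at_theta th0 thph).
  by apply: d'cov; rewrite ltrDl.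
set bound := (d - dL) * (dA - d) / _.
have step (e : R) : 0 < e -> d' <= d + bound * (phi - theta) +
    e * (1 + 2 * (phi - theta) / theta).
  (* These are the gaps between the shifted exponents [dA + e], [d + e] and [dL - e]. The shift
     keeps [B] positive when [d = dL], so that [D] does not vanish. *)
  move=> e0; pose A := dA - d; pose B := d - dL + 2 * e.
  have A0 : 0 <= A by rewrite subr_ge0.
  have B0 : 0 < B by rewrite /B; lra.
  have thA : 0 <= theta * A by rewrite mulr_ge0// ltW.
  have phB : 0 < phi * B by rewrite mulr_gt0.
  pose D := theta * A + phi * B.
  have D0 : 0 < D by rewrite /D; lra.
  have AB0 : 0 < A + B by lra.
  (* [gamma * theta] is the mean of [theta] and [phi] with weights [A] and [B], hence lies between
     them; with [t] below, both exponent conditions of the transfer become equalities. *)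
  pose gamma := D / (theta * (A + B)).
  pose q := A * B / D.
  have q0 : 0 <= q by rewrite divr_ge0 ?mulr_ge0// ltW.
  have pt0 : 0 <= phi - theta by rewrite subr_ge0.
  pose t := d + e + q * (phi - theta).
  have gaE : gamma * theta = D / (A + B) by rewrite /gamma; field; rewrite !gt_eqF.
  have [K HK] : covered_at b F theta (d + e) by apply: dcov; rewrite ltrDl.
  have [||||||||||e1 [K' [e10 He1]]] := @scale_cover_transfer R X F theta phi
     (dA + e) (dL - e) (d + e) t gamma K totF (assouadbF _) (contentF _) th0 thph ph1.
  - by rewrite ltrDl.
  - by rewrite ltrBlDr ltrDl.
  - by rewrite addr_ge0 ?(ltW e0)// (le_trans dL0).
  - lra.
  - lra.
  - by rewrite /t lerDl mulr_ge0.
  - rewrite /gamma ler_pdivlMr ?mulr_gt0// mul1r mulrDr lerD2l ler_pM2r//.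
  - rewrite gaE ler_pdivrMr// mulrDr lerD2r; apply: ler_wpM2r => //.
  - have -> : dA + e - t = A - q * (phi - theta) by rewrite /t /A; ring.
    have -> : dA + e - (d + e) = A by rewrite /A; ring.
    rewrite le_eqVlt; apply/orP; left; apply/eqP.
    rewrite /gamma /q /D; field; rewrite -/D !gt_eqF//.
  - have -> : t - (dL - e) = B + q * (phi - theta) by rewrite /t /B; ring.
    have -> : d + e - (dL - e) = B by rewrite /B; ring.
    rewrite gaE le_eqVlt; apply/orP; left; apply/eqP.
    rewrite /q /D; field; rewrite -/D !gt_eqF//.
  have ga0 : 0 < gamma by rewrite divr_gt0 ?mulr_gt0.
  have : d' <= t.
    apply: covd'; exists K'; move: HK.
    apply: (@small_scales_map _ _ _ _ 1 gamma e1) => // x xe Hx.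
    by rewrite mul1r; exact: He1.
  move=> /le_trans; apply; rewrite /t.
  have H : q <= bound + 2 * e / theta.
    apply: parallel_sum_le; rewrite ?subr_ge0 ?mulr_gt0//.
    by have := dLA; rewrite /A; lra.
  have := ler_wpM2r pt0 H.
  have -> : (bound + 2 * e / theta) * (phi - theta) =
    bound * (phi - theta) + e * (2 * (phi - theta) / theta) by ring.
  by rewrite [e * (1 + _)]mulrDr mulr1; lra.
apply/ler_addgt0Pr => e e0.
have k0 : 0 < 1 + 2 * (phi - theta) / theta.
  by rewrite ltr_wpDr// divr_ge0 ?mulr_ge0 ?subr_ge0// ltW.
by have := step _ (divr_gt0 e0 k0); rewrite divfK// gt_eqF.
Qed.

Let dim b theta : R := fine (intermediate_dim b theta F).

Let dimE b theta : 0 < theta <= 1 ->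
  intermediate_dim b theta F = (dim b theta)%:E /\ dL <= dim b theta <= dA.
Proof. by move=> /(intermediate_dimP b)[d [dE H _ _]]; rewrite /dim dE. Qed.

Lemma intermediate_dim_lipschitz b theta : 0 < theta ->
  (dA / (4 * theta)).-lipschitz_(`[theta, 1]) (dim b).
Proof.
move=> th0; have dL0' := dL0; have dLA' := dLA.
have H u v : theta <= u -> u <= v -> v <= 1 ->
    `|dim b u - dim b v| <= dA / (4 * theta) * `|u - v|.
  move=> thu uv v1; have u0 : 0 < u by exact: lt_le_trans thu.
  have v0 : 0 < v by exact: lt_le_trans uv.
  have [|uE /andP[dLu udA]] := @dimE b u; first by rewrite u0 (le_trans uv).
  have [|vE _] := @dimE b v; first by rewrite v0.
  have := intermediate_dim_bound u0 uv v1 uE vE.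
  set d := dim b u in dLu udA *; set d' := dim b v.
  set A := dA - d; set B := d - dL; move=> /andP[dd' d'd].
  have A0 : 0 <= A by rewrite subr_ge0.
  have B0 : 0 <= B by rewrite subr_ge0.
  have AB : 0 < A + B by rewrite /A /B; lra.
  have vB : theta * B <= v * B by rewrite ler_wpM2r//; lra.
  have uA : theta * A <= u * A by rewrite ler_wpM2r.
  have D0 : 0 < v * B + u * A.
    have : 0 < theta * (A + B) by rewrite mulr_gt0.
    rewrite mulrDr; lra.
  (* As [u] and [v] are at least [theta], the denominator is at least [theta * (A + B)]; moreover
     [4 * A * B <= (A + B)^2], and [A + B = dA - dL <= dA] since [dL] is nonnegative. *)
  have q : B * A / (v * B + u * A) <= dA / (4 * theta).
    rewrite ler_pdivrMr// mulrAC ler_pdivlMr ?mulr_gt0//.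
    have : dA * (theta * (A + B)) <= dA * (v * B + u * A).
      by apply: ler_wpM2l; [lra|rewrite mulrDr; lra].
    apply: le_trans.
    have : (A + B) * (theta * (A + B)) <= dA * (theta * (A + B)).
      by rewrite ler_wpM2r ?mulr_ge0 ?(ltW th0) ?(ltW AB)// /A /B; lra.
    apply: le_trans; rewrite -subr_ge0.
    have -> : (A + B) * (theta * (A + B)) - B * A * (4 * theta) =
      theta * (A - B) ^+ 2 by ring.
    by rewrite mulr_ge0 ?sqr_ge0// ltW.
  rewrite (distrC d) (distrC u) !ger0_norm ?subr_ge0//.
  have vu : 0 <= v - u by rewrite subr_ge0.
  by have := ler_wpM2r vu q; lra.
move=> [u v] /= [/itvP uI /itvP vI].
have [uv|vu] := leP u v; first by apply: H; rewrite ?uI ?vI.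
by rewrite distrC (distrC u); apply: H; rewrite ?uI ?vI// ltW.
Qed.

Lemma intermediate_dim_continuous b : {within `]0, 1], continuous (dim b)}.
Proof.
apply/subspace_continuousP => t; rewrite /= in_itv/= => /andP[t0 t1].
(* The Lipschitz constant blows up at 0, but the interval from [t / 2] to 1 is a neighbourhood of
   [t] in the domain on which one constant serves. *)
have t20 : 0 < t / 2 by rewrite divr_gt0.
have lip := intermediate_dim_lipschitz b t20.
set L := dA / _ in lip.
have L0 : 0 < L.
  by rewrite divr_gt0 ?mulr_gt0//; exact: le_lt_trans dLA.
apply/cvgrPdist_le => e e0; rewrite near_withinE; apply/nbhs_ballP.
exists (Num.min (t / 2) (e / L)); first by rewrite /= lt_min t20 divr_gt0.
move=> u; rewrite /ball/= lt_min => /andP[tu tue]; rewrite in_itv/= => /andP[u0 u1].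
have t2u : t / 2 <= u by move: tu; rewrite ltr_norml => /andP[_]; lra.
have t2t : t / 2 <= t by lra.
have /= H := lip (t, u); apply: le_trans (H _) _.
  by rewrite !in_itv/= t1 u1 t2t t2u.
by rewrite mulrC -ler_pdivlMr// ltW.
Qed.

End intermediate_dim_bounds.

Theorem theorem3p12 (R : realType) (X : metricType R) (F : set X)
    (theta phi : R) :
  uniformly_perfect X ->
  (exists x y : X, x <> y) ->
  F !=set0 ->
  totally_bounded_set F ->
  (0 <= lower_dim F)%E ->
  (lower_dim F < assouad_dim F)%E ->
  (assouad_dim F < +oo)%E ->
  0 < theta -> theta <= phi -> phi <= 1 ->
  let dL := fine (lower_dim F) in
  let dA := fine (assouad_dim F) in
  let up := fun t : R => fine (upper_intermediate_dim t F) in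
  let lo := fun t : R => fine (lower_intermediate_dim t F) in
  [/\ forall t : R, 0 < t <= 1 ->
        upper_intermediate_dim t F \is a fin_num /\
        lower_intermediate_dim t F \is a fin_num,
      up theta <= up phi <=
        up theta + (up theta - dL) * (dA - up theta)
                   / (phi * (up theta - dL) + theta * (dA - up theta))
                   * (phi - theta),
      lo theta <= lo phi <=
        lo theta + (lo theta - dL) * (dA - lo theta)
                   / (phi * (lo theta - dL) + theta * (dA - lo theta))
                   * (phi - theta),
      {within `]0, 1], continuous up} /\ {within `]0, 1], continuous lo}
    & (dA / (4 * theta)).-lipschitz_(`[theta, 1]) up /\
      (dA / (4 * theta)).-lipschitz_(`[theta, 1]) lo].

Proof.
move=> upX /diamT_gt0 dX F0 totF dL0 dLA dAy th0 thph ph1 dL dA up lo.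
have dAfin : assouad_dim F \is a fin_num.
  rewrite fin_numE; apply/andP; split; apply/eqP => AE; last by rewrite AE in dAy.
  by have := le_lt_trans dL0 dLA; rewrite AE.
have dLfin : lower_dim F \is a fin_num.
  rewrite fin_numE; apply/andP; split; apply/eqP => LE; first by rewrite LE in dL0.
  by have := lt_trans dLA dAy; rewrite LE.
have lowerF : lower_dim F = dL%:E by rewrite fineK.
have assouadF : assouad_dim F = dA%:E by rewrite fineK.
have {dL0}dL0 : 0 <= dL by rewrite -lee_fin -lowerF.
have {dLA}dLA : dL < dA by rewrite -lte_fin -lowerF -assouadF.
have fin b t : 0 < t <= 1 -> intermediate_dim b t F \is a fin_num.
  move=> t01; have [d [-> _ _ _]] :=
    intermediate_dimP upX dX F0 totF lowerF assouadF dL0 b t01.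
  by [].
have th01 : 0 < theta <= 1 by rewrite th0 (le_trans thph).
have ph01 : 0 < phi <= 1 by rewrite (lt_le_trans th0).
have bound b := intermediate_dim_bound upX dX F0 totF lowerF assouadF dL0 dLA
  th0 thph ph1 (esym (fineK (fin b _ th01))) (esym (fineK (fin b _ ph01))).
have lip b := intermediate_dim_lipschitz upX dX F0 totF lowerF assouadF dL0 dLA b th0.
have cont b := intermediate_dim_continuous upX dX F0 totF lowerF assouadF dL0 dLA b.
split.
- by move=> t t01; split; [exact: (fin true)|exact: (fin false)].
- exact: (bound true).
- exact: (bound false).
- by split; [exact: (cont true)|exact: (cont false)].
- by split; [exact: (lip true)|exact: (lip false)].
Qed.
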